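(* Let $(\Omega,\preceq)$ be a totally preordered space with smallest element $0_\Omega$ and largest element $1_\Omega$, and assume that $\Omega/\simeq$ is order complete. Let $(\underline F,\overline F)$ be a p-box on $(\Omega,\preceq)$ with $0$–$1$-valued $\overline F$, and let $C=\{x\in\Omega^*:\overline F(x)=0\}$ and $C^c=\Omega^*\setminus C$. Then $(\underline F,\overline F)$ is a possibility measure if and only if (i) $\underline F(x)=\underline F(x+)$ for all $x\in\Omega$ that have no immediate successor, and (ii) $C$ has a maximum, and in such a case, for all $A\subseteq\Omega$, $$\overline E_{\underline F,\overline F}(A)=1-\inf_{y\in A\cap C^c}\underline F(y-).$$
   Context: A total preorder $\preceq$ is reflexive, transitive, with any two elements comparable; $x\prec y$ means $x\preceq y$ and not $y\preceq x$; $x\simeq y$ means $x\preceq y$ and $y\preceq x$; $\Omega/\simeq$ is the quotient with its induced total order, and it is order complete if every subset has a supremum and an infimum. A formal element $0_\Omega-$ is added: $\Omega^*=\Omega\cup\{0_\Omega-\}$ with $0_\Omega-\prec x$ for all $x\in\Omega$. Maxima of sets are with respect to the preorder (hence unique up to $\simeq$). $[0_\Omega,x]=\{z\in\Omega:z\preceq x\}$. A cumulative distribution function is a non-decreasing map $F:\Omega\to[0,1]$ with $F(1_\Omega)=1$, extended to $\Omega^*$ by $F(0_\Omega-)=0$. A p-box is a pair $(\underline F,\overline F)$ of cumulative distribution functions with $\underline F\le\overline F$. $F$ is $0$–$1$-valued if it takes only the values $0$ and $1$. For $x\in\Omega$, $F(x-)=\sup_{z\in\Omega^*,\,z\prec x}F(z)$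 and $F(x+)=\inf_{z\in\Omega,\,z\succ x}F(z)$. Infima (suprema) of numbers in $[0,1]$ over the empty set equal $1$ ($0$); in particular $F(1_\Omega+)=1$. An immediate successor of $x$ is a $y\succ x$ with no $z$ such that $x\prec z\prec y$. The natural extension of the p-box is $\overline E_{\underline F,\overline F}(A)=\sup P(A)$ for $A\subseteq\Omega$, the supremum being over all finitely additive probabilities $P$ on the power set of $\Omega$ with $\underline F(x)\le P([0_\Omega,x])\le\overline F(x)$ for all $x\in\Omega$. The p-box ''is a possibility measure'' if $\overline E_{\underline F,\overline F}(A)=\sup_{x\in A}\overline E_{\underline F,\overline F}(\{x\})$ for all $A\subseteq\Omega$. *)

(* Defs.v *)
From HB Require Import structures.
From mathcomp Require Import all_boot all_order all_algebra.
From mathcomp Require Import all_classical all_reals.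

Set Implicit Arguments.
Unset Strict Implicit.
Unset Printing Implicit Defensive.

Import Order.PreorderTheory GRing.Theory Num.Theory.

Local Open Scope classical_set_scope.
Local Open Scope ring_scope.
Local Open Scope order_scope.
Local Open Scope quotient_scope.

Section Quotient.
Context (d : Order.disp_t) (T : preorderType d).

Definition simeq : rel T := [rel x y | (x <= y) && (y <= x)].

Lemma simeq_refl : reflexive simeq.
Proof. by move=> x; rewrite /simeq /= lexx. Qed.

Lemma simeq_sym : symmetric simeq.
Proof. by move=> x y; rewrite /simeq /= andbC. Qed.

Lemma simeq_trans : transitive simeq.
Proof.
move=> y x z /= /andP[xy yx] /andP[yz zy].
by apply/andP; split; [exact: le_trans yz|exact: le_trans yx].
Qed.

Canonical simeq_equiv := EquivRel simeq simeq_refl simeq_sym simeq_trans.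

Definition squot := {eq_quot simeq_equiv}.
HB.instance Definition _ := Choice.on squot.
HB.instance Definition _ := EqQuotient.on squot.

Definition squot_le : rel squot := [rel a b | repr a <= repr b].

Lemma squot_leE (x y : T) : squot_le (\pi_squot x) (\pi_squot y) = (x <= y).
Proof.
have reprP z : simeq (repr (\pi_squot z)) z.
  by apply/eqmodP; rewrite reprK.
have /andP[x1 x2] := reprP x; have /andP[y1 y2] := reprP y.
apply/idP/idP => /= [xy|xy].
  exact: le_trans x2 (le_trans xy y1).
exact: le_trans x1 (le_trans xy y2).
Qed.

Lemma squot_le_refl : reflexive squot_le.
Proof. by move=> a; rewrite /squot_le /= lexx. Qed.

Lemma squot_le_anti : antisymmetric squot_le.
Proof.
move=> a b ab; rewrite -[a]reprK -[b]reprK.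
exact/eqmodP.
Qed.

Lemma squot_le_trans : transitive squot_le.
Proof. by move=> b a c; exact: le_trans. Qed.

HB.instance Definition _ := Order.Le_isPOrder.Build d squot
  squot_le_refl squot_le_anti squot_le_trans.

End Quotient.

Definition order_complete (d : Order.disp_t) (T : porderType d) : Prop :=
  forall S : set T, supremums S !=set0 /\ infimums S !=set0.

(* [star T] is [T] with an extra smallest element [None], the formal 0-. *)
Definition star (T : Type) : Type := option T.

Section Star.
Context (d : Order.disp_t) (T : preorderType d).

HB.instance Definition _ := Choice.copy (star T) (option T).

Definition star_le : rel (star T) := fun a b =>
  match a, b with
  | None, _ => true
  | Some _, None => false
  | Some x, Some y => x <= y
  end.

Lemma star_le_refl : reflexive star_le.
Proof. by case=> //= x; exact: lexx. Qed.

Lemma star_le_trans : transitive star_le.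
Proof. by move=> [y|] [x|] [z|] //=; exact: le_trans. Qed.

HB.instance Definition _ :=
  Order.Le_isPreorder.Build d (star T) star_le_refl star_le_trans.

End Star.

Definition is_max (d : Order.disp_t) (T : preorderType d) (S : set T) (m : T)
  : Prop := S m /\ forall x, S x -> x <= m.

Definition immediate_succ (d : Order.disp_t) (T : preorderType d) (x y : T)
  : Prop := x < y /\ ~ exists z, x < z < y.

(* Infimum of a set of numbers in [0, 1], with value 1 on the empty set. The
   dual convention needs no definition, since [sup set0 = 0]. *)
Definition inf01 (R : realType) (S : set R) : R :=
  if S == set0 then 1%R else inf S.

Section PBox.
Context (R : realType) (d : Order.disp_t) (T : tbPreorderType d).
Implicit Types (F Fl Fu : T -> R) (A : set T) (P : set T -> R).

Definition cdf F : Prop :=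
  [/\ forall x, (0 <= F x <= 1)%R,
      {homo F : x y / x <= y >-> (x <= y)%R} &
      F \top = 1%R].

Definition pbox Fl Fu : Prop :=
  [/\ cdf Fl, cdf Fu & forall x, (Fl x <= Fu x)%R].

Definition zero_one_valued F : Prop := forall x, F x = 0%R \/ F x = 1%R.

Definition cdf_star F : star T -> R := fun z => if z is Some x then F x else 0%R.

(* F(x-) *)
Definition cdf_left F (x : T) : R :=
  sup [set cdf_star F z | z in [set z : star T | z < (Some x : star T)]].

(* F(x+) *)
Definition cdf_right F (x : T) : R :=
  inf01 [set F z | z in [set z : T | x < z]].

Definition fin_add_proba P : Prop :=
  [/\ forall A, (0 <= P A)%R,
      P [set: T] = 1%R &
      forall A B, A `&` B = set0 -> P (A `|` B) = (P A + P B)%R].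

Definition credal Fl Fu : set (set T -> R) :=
  [set P | fin_add_proba P /\
    forall x, (Fl x <= P [set z | (z <= x)%O] <= Fu x)%R].

Definition natural_extension Fl Fu A : R := sup [set P A | P in credal Fl Fu].

Definition is_possibility Fl Fu : Prop := forall A,
  natural_extension Fl Fu A = sup [set natural_extension Fl Fu [set x] | x in A].

Definition zero_set F : set (star T) := [set z | cdf_star F z = 0%R].

End PBox.

(* Main.v *)
(* Let [Q] be an ultrafilter charge concentrated at the start of [{Fu = 1}].
   For [y] with [Fu y = 1], moving mass [Fl(y-)] to [Q] and the rest to [y] is
   always admissible, so the upper probability of [{y}] is exactly
   [1 - Fl(y-)], while it is [0] where [Fu] vanishes.  The upper bound on a
   general event [A] comes from the infimum of [A] minus [C]: when it is not
   attained it has no immediate successor, and (i) applies to it; (ii) makes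
   [C] negligible.  If (i) fails at [x], mass [1 - Fl x] can be put just above
   [x]; if (ii) fails, all the mass can be put at the end of [C]. *)
Require Import Defs.
From HB Require Import structures.
From mathcomp Require Import all_boot all_order all_algebra.
From mathcomp Require Import all_classical all_reals.
From mathcomp Require Import lra.

Import Order.Theory GRing.Theory Num.Theory.

Local Open Scope classical_set_scope.
Local Open Scope ring_scope.

(** * Infima in [0, 1] with value 1 on the empty set *)

Section Inf01.
Context {R : realType}.
Implicit Types (S : set R) (c r : R).

Lemma inf01_set0 : inf01 (@set0 R) = 1.
Proof. by rewrite /inf01 eqxx. Qed.

(** The condition [c <= 1] covers the empty set, where the infimum is 1. *)
Lemma inf01_ge S c : c <= 1 -> lbound S c -> c <= inf01 S.
Proof.
rewrite /inf01; case: eqVneq => // /set0P S0 _ cS.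
exact: lb_le_inf.
Qed.

Lemma inf01_le S r : lbound S 0 -> S r -> inf01 S <= r.
Proof.
move=> S0 Sr; rewrite /inf01; case: eqP => [Se|_]; first by rewrite Se in Sr.
by apply: ge_inf => //; exists 0.
Qed.

End Inf01.

(** * Total preorders and greatest lower bounds *)

Section TotalPreorder.
Context {d : Order.disp_t} {T : preorderType d}.
Hypothesis tot : total (<=%O : rel T).

Lemma total_leNgt (x y : T) : ~ (x <= y)%O <-> (y < x)%O.
Proof.
split=> [/negP xy|yx xy]; last by have := le_lt_trans xy yx; rewrite ltxx.
by rewrite lt_leAnge xy andbT; case/orP: (tot x y) xy => [->|].
Qed.

Lemma total_ltNge (x y : T) : ~ (x < y)%O <-> (y <= x)%O.
Proof.
split=> [xy|yx xy]; last by move/total_leNgt: xy.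
by apply: contrapT => /total_leNgt.
Qed.

(** The infimum is taken in the quotient and pulled back by [repr], so it is determined only up to
    equivalence. *)
Lemma order_complete_glb (B : set T) : order_complete (squot T) ->
  exists b : T, (forall y, B y -> (b <= y)%O) /\
    (forall z, (forall y, B y -> (z <= y)%O) -> (z <= b)%O).
Proof.
move=> /(_ [set \pi_(squot T)%qT x | x in B]) [_ [a [aB a_glb]]].
have leE (x y : T) : (\pi_(squot T)%qT x <= \pi_(squot T)%qT y)%O = (x <= y)%O.
  exact: squot_leE.
exists (repr a); split=> [y By|z zB].
  by rewrite -leE reprK; apply: aB; exists y.
rewrite -leE reprK; apply: a_glb => _ [y By <-].
by rewrite leE; exact: zB.
Qed.

End TotalPreorder.

(** * Finitely additive probabilities and ultrafilter charges *)

Section FinAddProba.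
Context {R : realType} {d : Order.disp_t} {T : tbPreorderType d}.
Implicit Types (P Q : set T -> R) (A B S : set T).

(* [fin_add_proba] reads [`&`] and [`|`] as the lattice operations of [set T],
   which are only convertible to the intersection and the union. *)
Lemma fin_add_probaP P : fin_add_proba P <->
  [/\ forall A, 0 <= P A, P setT = 1 &
      forall A B, (A `&` B)%classic = set0 ->
        P (A `|` B)%classic = P A + P B].
Proof. by []. Qed.

Lemma fin_add_probaC P A : fin_add_proba P -> P (~` A) = 1 - P A.
Proof.
move=> /fin_add_probaP[_ PT PU]; have := PU A (~` A) (setICr A).
by rewrite setUv PT => ->; rewrite addrC addKr.
Qed.

Lemma fin_add_proba_le P A B : fin_add_proba P -> A `<=` B -> P A <= P B.
Proof.
move=> /fin_add_probaP[P0 _ PU] AB; have -> : B = A `|` (B `\` A) by rewrite setDUK.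
by rewrite PU ?setDIK// lerDl.
Qed.

Lemma fin_add_proba_le1 P A : fin_add_proba P -> P A <= 1.
Proof.
by move=> PP; case: (PP) => _ <- _; exact: fin_add_proba_le.
Qed.

Lemma fin_add_proba_le_disj P A B : fin_add_proba P -> A `<=` ~` B ->
  P A <= 1 - P B.
Proof. by move=> PP AB; rewrite -fin_add_probaC//; exact: fin_add_proba_le. Qed.

Lemma fin_add_proba_mix (c : R) P Q : 0 <= c <= 1 ->
  fin_add_proba P -> fin_add_proba Q ->
  fin_add_proba (fun A => c * P A + (1 - c) * Q A).
Proof.
move=> /andP[c0 c1] [P0 PT PU] [Q0 QT QU]; split=> [A||A B AB].
- by rewrite addr_ge0 ?mulr_ge0 ?subr_ge0.
- by rewrite PT QT; lra.
- by rewrite PU// QU//; lra.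
Qed.

(** Membership in an ultrafilter containing [F] is a charge with values 0 and 1. *)
Lemma proper_filter_proba (F : set_system T) : ProperFilter F ->
  exists P : set T -> R, fin_add_proba P /\ forall A, F A -> P A = 1.
Proof.
move=> /ultraFilterLemma[U [UU FU]].
exists (fun A => `[< U A >]%:R); split; last by move=> A /FU /asboolT ->.
have notU A B : A `&` B = set0 -> U A -> ~ U B.
  move=> AB UA UB; apply: (@filter_not_empty _ U _).
  by rewrite -AB; exact: filterI.
split=> [A||A B AB]; first exact: ler0n.
  by rewrite asboolT//; exact: filterT.
have [UA|nUA] := pselect (U A).
  rewrite (asboolT UA) (asboolF (notU _ _ AB UA)) asboolT ?addr0//.
  by apply: filterS UA => x; left.
have [UB|nUB] := pselect (U B).
  rewrite (asboolF nUA) (asboolT UB) asboolT ?add0r//.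
  by apply: filterS UB => x; right.
rewrite !asboolF ?addr0// => UAB.
(* The complement of [A] is in [U], and it meets the union of [A] and [B] inside [B]. *)
have [//|UnA] := in_ultra_setVsetC A UU; apply: nUB.
by apply: filterS (filterI UAB UnA) => x [[]].
Qed.

(** A nested family of nonempty sets is a base of a proper filter. *)
Lemma nested_proba S (B : T -> set T) : S !=set0 ->
  (forall x, S x -> B x !=set0) ->
  (forall x y, S x -> S y -> B x `<=` B y \/ B y `<=` B x) ->
  exists P : set T -> R, fin_add_proba P /\
    forall x A, S x -> B x `<=` A -> P A = 1.
Proof.
move=> S0 B0 BB; have FF : Filter (filter_from S B).
  apply: filter_from_filter => // x y Sx Sy.
  by have [xy|yx] := BB _ _ Sx Sy; [exists x|exists y] => // z Bz; split;
    rewrite //; auto.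
have [P [PP P1]] := proper_filter_proba _ (filter_from_proper FF B0).
by exists P; split=> // x A Sx xA; apply: P1; exists x.
Qed.

Hypothesis tot : total (<=%O : rel T).

(** The initial segments of [S] are nested and nonempty even if [S] has no smallest element; the
    charge plays the role of a point mass there. *)
Lemma start_proba S : S !=set0 ->
  exists P : set T -> R, fin_add_proba P /\
    forall x A, S x -> (forall z, S z -> (z <= x)%O -> A z) -> P A = 1.
Proof.
move=> S0.
have [||P [PP P1]] := nested_proba S (fun x => S `&` [set z | (z <= x)%O]) S0.
- by move=> x Sx; exists x; split=> //=; exact: lexx.
- move=> x y _ _; case/orP: (tot x y) => xy; [left|right] => z [Sz zx];
    split=> //; exact: le_trans xy.
- by exists P; split=> // x A Sx SA; apply: (P1 x) => // z [Sz zx]; exact: SA.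
Qed.

(** Dual construction, with the final segments of [S]. *)
Lemma end_proba S : S !=set0 ->
  exists P : set T -> R, fin_add_proba P /\
    forall x A, S x -> (forall z, S z -> (x <= z)%O -> A z) -> P A = 1.
Proof.
move=> S0.
have [||P [PP P1]] := nested_proba S (fun x => S `&` [set z | (x <= z)%O]) S0.
- by move=> x Sx; exists x; split=> //=; exact: lexx.
- move=> x y _ _; case/orP: (tot x y) => xy; [right|left] => z [Sz zx];
    split=> //; exact: le_trans zx.
- by exists P; split=> // x A Sx SA; apply: (P1 x) => // z [Sz zx]; exact: SA.
Qed.

End FinAddProba.

(** * One-sided limits of a distribution function *)

Section Cdf.
Context {R : realType} {d : Order.disp_t} {T : tbPreorderType d}.
Variable F : T -> R.
Hypothesis cdfF : cdf F.

Let star_ltE (x y : T) :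
  ((Some x : star T) < (Some y : star T))%O = (x < y)%O.
Proof. by rewrite !lt_leAnge. Qed.

Lemma cdf_left_ubound (y : T) :
  ubound [set cdf_star F z | z in [set z : star T | (z < (Some y : star T))%O]] 1.
Proof. by case: cdfF => F01 _ _ _ [[x|] _ <-] //=; case/andP: (F01 x). Qed.

Lemma cdf_left_ge (x y : T) : (x < y)%O -> F x <= cdf_left F y.
Proof.
move=> xy; apply: ub_le_sup; first by exists 1; exact: cdf_left_ubound.
by exists (Some x); rewrite //= star_ltE.
Qed.

(** The condition [0 <= c] accounts for the added point [None], where the extended function is 0. *)
Lemma cdf_left_le (y : T) (c : R) : 0 <= c ->
  (forall x, (x < y)%O -> F x <= c) -> cdf_left F y <= c.
Proof.
move=> c0 Fc; apply: ge_sup; first by exists 0, None.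
by move=> _ [[x|] /= xy <-] //; apply: Fc; rewrite -star_ltE.
Qed.

Lemma cdf_left01 (y : T) : 0 <= cdf_left F y <= 1.
Proof.
apply/andP; split.
  by apply: ub_le_sup; [exists 1; exact: cdf_left_ubound|exists None].
by apply: cdf_left_le => // x _; case: cdfF => /(_ x)/andP[].
Qed.

Lemma cdf_right_le (x y : T) : (x < y)%O -> cdf_right F x <= F y.
Proof.
move=> xy; apply: inf01_le; last by exists y.
by case: cdfF => F01 _ _ _ [z _ <-]; case/andP: (F01 z).
Qed.

Lemma cdf_right_ge (x : T) : F x <= cdf_right F x.
Proof.
case: cdfF => F01 Fh _; apply: inf01_ge; first by case/andP: (F01 x).
by move=> _ [z xz <-]; apply: Fh; exact: ltW.
Qed.

End Cdf.

(** * Admissible charges of a p-box with 0-1-valued upper bound *)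

Section ZeroOnePBox.
Context {R : realType} {d : Order.disp_t} {T : tbPreorderType d}.
Variables Fl Fu : T -> R.
Hypotheses (tot : total (<=%O : rel T)) (FlFu : pbox Fl Fu)
  (Fu01 : zero_one_valued Fu).
Implicit Types (x y : T) (A S : set T) (P : set T -> R).

Let Fl_ge0 x : 0 <= Fl x.
Proof. by case: FlFu => -[F01 _ _] _ _; case/andP: (F01 x). Qed.

Let Fl_le1 x : Fl x <= 1.
Proof. by case: FlFu => -[F01 _ _] _ _; case/andP: (F01 x). Qed.

Let Fl_homo x y : (x <= y)%O -> Fl x <= Fl y.
Proof. by case: FlFu => -[_ + _] _ _; exact. Qed.

Let Fu_homo x y : (x <= y)%O -> Fu x <= Fu y.
Proof. by case: FlFu => _ [_ + _] _; exact. Qed.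

Let cdfFl : cdf Fl. Proof. by case: FlFu. Qed.

Let Fu_top : Fu \top%O = 1. Proof. by case: FlFu => _ []. Qed.

Let Fl_le_Fu x : Fl x <= Fu x. Proof. by case: FlFu. Qed.

Let Fu_neq0 x : Fu x <> 0 -> Fu x = 1.
Proof. by case: (Fu01 x). Qed.

Let Fu_lt x y : Fu x = 0 -> Fu y = 1 -> (x < y)%O.
Proof.
by move=> x0 y1; apply/(total_leNgt tot) => /Fu_homo; rewrite x0 y1 ler10.
Qed.

(* The mass [c] sits at the start of [{Fu = 1}], the mass [1 - c] at the start
   of [S]. *)
Lemma credal_concentrated S (c : R) : S !=set0 -> 0 <= c <= 1 ->
  (forall y, S y -> Fu y = 1) ->
  (forall w, (exists2 s, S s & (s <= w)%O) \/ Fl w <= c) ->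
  exists2 P, credal Fl Fu P & 1 - c <= P S.
Proof.
move=> S0 c01 S1 Sc; have [c0 c1] := andP c01.
have [|Q [QQ Q1]] := @start_proba R _ _ tot [set y | Fu y = 1].
  by exists \top%O.
have [U [UU U1]] := @start_proba R _ _ tot S S0.
exists (fun A => c * Q A + (1 - c) * U A); last first.
  have [s Ss] := S0; rewrite (U1 s)// mulr1 lerDr mulr_ge0//.
  by case: QQ.
split=> [|x]; first exact: fin_add_proba_mix.
(* If [Fu x = 0], both charges vanish on the segment up to [x]. *)
have [x0|x1] := Fu01 x.
  have Ax z : Fu z = 1 -> ~ (z <= x)%O.
    by move=> z1; apply/total_leNgt => //; exact: Fu_lt.
  have zero P : fin_add_proba P -> P (~` [set z | (z <= x)%O]) = 1 ->
      P [set z | (z <= x)%O] = 0.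
    by move=> PP; rewrite fin_add_probaC// => ?; lra.
  rewrite !zero//; first by have := Fl_le_Fu x; rewrite x0; lra.
    by have [s Ss] := S0; apply: (U1 s) => // z Sz _; apply: Ax; exact: S1.
  by apply: (Q1 \top%O) => // z z1 _; exact: Ax.
have -> : Q [set z | (z <= x)%O] = 1 by apply: (Q1 x).
have UA0 : 0 <= U [set z | (z <= x)%O] by case: UU.
have UA1 := fin_add_proba_le1 U [set z | (z <= x)%O] UU.
rewrite x1 mulr1; apply/andP; split; last by nra.
(* The segment has [Q]-mass 1, hence total mass at least [c], which suffices if [Fl x <= c]. If it
   contains a point of [S], its total mass is 1. *)
have [[s Ss sx]|Flx] := Sc x; last by nra.
rewrite (U1 s) //; first by rewrite mulr1 addrC subrK.
by move=> z _ zs; exact: le_trans sx.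
Qed.

(** Here [S] is the singleton and [c] is [Fl(x-)], which dominates [Fl] strictly below [x]. *)
Lemma credal_at x : Fu x = 1 ->
  exists2 P, credal Fl Fu P & 1 - cdf_left Fl x <= P [set x].
Proof.
move=> x1; apply: credal_concentrated; first by exists x.
- exact: cdf_left01.
- by move=> _ ->.
- move=> w; have [xw|/(total_leNgt tot) wx] := pselect (x <= w)%O.
    by left; exists x.
  by right; exact: cdf_left_ge.
Qed.

Lemma credal_above x : (x < \top)%O ->
  exists2 P, credal Fl Fu P & 1 - Fl x <= P [set z | (x < z)%O].
Proof.
move=> xtop.
have [||||P cP PS] := @credal_concentrated [set z | (x < z)%O /\ Fu z = 1] (Fl x).
- by exists \top%O.
- by rewrite Fl_ge0 Fl_le1.
- by move=> y [].
- move=> w; have [xw|/(total_ltNge tot) wx] := pselect (x < w)%O; last first.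
    by right; exact: Fl_homo.
  have [w0|w1] := Fu01 w; last by left; exists w.
  (* A point above [x] but not above any point of [{Fu = 1}] causes no trouble: [Fl w] is squeezed
     to 0. *)
  by right; rewrite (le_trans (Fl_le_Fu w))// w0.
- exists P => //; apply: le_trans PS _; apply: fin_add_proba_le; first by case: cP.
  by move=> z [].
Qed.

(** A segment ending inside [{Fu = 0}] misses a final part of that set and has mass 0; a segment
    ending in [{Fu = 1}] contains all of it and has mass 1. *)
Lemma credal_end_zero_set :
  (exists x, Fu x = 0) -> (forall x, Fu x = 0 -> exists2 y, Fu y = 0 & (x < y)%O) ->
  exists2 P, credal Fl Fu P & P [set x | Fu x = 0] = 1.
Proof.
move=> C0 Cmax; have [U [UU U1]] := @end_proba R _ _ tot [set x | Fu x = 0] C0.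
have [x0 Cx0] := C0; exists U; last exact: (U1 x0).
split=> // x; have [x0'|x1] := Fu01 x.
  have [y y0 xy] := Cmax _ x0'.
  have : U (~` [set z | (z <= x)%O]) = 1.
    apply: (U1 y) => // z _ yz; apply/(total_leNgt tot).
    exact: lt_le_trans yz.
  rewrite fin_add_probaC// => U0; have := Fl_le_Fu x; rewrite x0'; lra.
rewrite (U1 x0) => [|//|z z0 _]; first by rewrite Fl_le1 x1 lexx.
by apply: ltW; exact: Fu_lt.
Qed.

(** * Bounds on upper probabilities and their values on singletons *)

Lemma natural_extension_ge P A : credal Fl Fu P ->
  P A <= natural_extension Fl Fu A.
Proof.
move=> cP; apply: ub_le_sup; last by exists P.
by exists 1 => _ [Q [QQ _] <-]; exact: fin_add_proba_le1.
Qed.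

Lemma natural_extension_le A (c : R) : (forall P, credal Fl Fu P -> P A <= c) ->
  natural_extension Fl Fu A <= c.
Proof.
move=> Pc; apply: ge_sup; last by move=> _ [P cP <-]; exact: Pc.
(* The supremum is over a nonempty set, since an admissible charge exists at the top. *)
by have [P cP _] := credal_at _ Fu_top; exists (P A), P.
Qed.

Lemma natural_extension_mono A B : A `<=` B ->
  natural_extension Fl Fu A <= natural_extension Fl Fu B.
Proof.
move=> AB; apply: natural_extension_le => P cP.
apply: le_trans (natural_extension_ge P B cP).
by apply: fin_add_proba_le => //; case: cP.
Qed.

Lemma natural_extension_ge0 A : 0 <= natural_extension Fl Fu A.
Proof.
have [P cP _] := credal_at _ Fu_top.
by apply: le_trans (natural_extension_ge P A cP); case: cP => -[].
Qed.

Lemma natural_extension_le1 A : natural_extension Fl Fu A <= 1.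
Proof.
by apply: natural_extension_le => P [PP _]; exact: fin_add_proba_le1.
Qed.

(** For each [x < y] the segment up to [x] is disjoint from [A] and has mass at least [Fl x]; then
    take the supremum over [x]. *)
Lemma credal_le_cdf_left P A y : credal Fl Fu P ->
  (forall z, A z -> (y <= z)%O) -> P A <= 1 - cdf_left Fl y.
Proof.
move=> [PP Pb] Ay; rewrite lerBrDl -lerBrDr.
apply: cdf_left_le => [|x xy]; first by rewrite subr_ge0 fin_add_proba_le1.
have : P A <= 1 - P [set z | (z <= x)%O].
  apply: fin_add_proba_le_disj => // z /Ay yz; apply/(total_leNgt tot).
  exact: lt_le_trans yz.
by case/andP: (Pb x); lra.
Qed.

Lemma natural_extension1 x : Fu x = 1 ->
  natural_extension Fl Fu [set x] = 1 - cdf_left Fl x.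
Proof.
move=> x1; apply/eqP; rewrite eq_le; apply/andP; split.
  by apply: natural_extension_le => P cP; apply: credal_le_cdf_left => // z ->.
by have [P cP /le_trans] := credal_at _ x1; apply; exact: natural_extension_ge.
Qed.

Lemma natural_extension1_zero x : Fu x = 0 ->
  natural_extension Fl Fu [set x] = 0.
Proof.
move=> x0; apply/eqP; rewrite eq_le natural_extension_ge0 andbT.
apply: natural_extension_le => P [PP Pb].
case/andP: (Pb x) => _; rewrite x0; apply: le_trans.
by apply: fin_add_proba_le => // z ->; exact: lexx.
Qed.

(** * Necessity of (i) and (ii) *)

Lemma possibility_cdf_right x : is_possibility Fl Fu ->
  ~ (exists y, immediate_succ x y) -> Fl x = cdf_right Fl x.
Proof.
move=> poss nsucc; apply/eqP; rewrite eq_le cdf_right_ge//=.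
have [xtop|/(total_ltNge tot) topx] := pselect (x < \top)%O; last first.
  (* Nothing lies above [x], so the right limit is an infimum over the empty set. *)
  have -> : cdf_right Fl x = 1.
    rewrite -inf01_set0; congr inf01; rewrite -subset0 => ? [z xz _].
    have := lt_le_trans xz (le_trans (lex1 z) topx).
    by rewrite ltxx.
  by case: cdfFl => _ _ <-; exact: Fl_homo.
have [P cP Pabove] := credal_above _ xtop.
(* The upper probability of this set is at least [1 - Fl x]; the possibility property reduces its
   upper bound to singletons. *)
suff : natural_extension Fl Fu [set z | (x < z)%O] <= 1 - cdf_right Fl x.
  by have := natural_extension_ge _ [set z | (x < z)%O] cP; lra.
rewrite poss; apply: ge_sup.
  by exists (natural_extension Fl Fu [set \top%O]), \top%O.
move=> _ [z xz <-].
(* An intermediate [w] gives [Fl(x+) <= Fl w <= Fl(z-)]. *)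
have [w /andP[xw wz]] : exists w, (x < w < z)%O.
  by apply: contrapT => nw; apply: nsucc; exists z.
have xw_right := cdf_right_le _ cdfFl _ _ xw.
have [z0|z1] := Fu01 z.
  by rewrite natural_extension1_zero//; have := Fl_le1 w; lra.
by rewrite natural_extension1//; have := cdf_left_ge _ cdfFl _ _ wz; lra.
Qed.

Lemma possibility_zero_set_max : is_possibility Fl Fu ->
  exists m, is_max (zero_set Fu) m.
Proof.
move=> poss; apply: contrapT => nomax.
have Cmax x : Fu x = 0 -> exists2 y, Fu y = 0 & (x < y)%O.
  move=> x0; apply: contrapT => xmax; apply: nomax; exists (Some x).
  split=> // -[y|] // y0; apply/(total_ltNge tot) => xy.
  by apply: xmax; exists y.
(* Otherwise [C] would contain only [None], which would be its maximum. *)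
have C0 : exists x, Fu x = 0.
  apply: contrapT => nC; apply: nomax; exists None; split=> // -[y|] // y0.
  by exfalso; apply: nC; exists y.
have [P cP P1] := credal_end_zero_set C0 Cmax.
(* This event has upper probability 1, but each of its points has upper probability 0. *)
have := natural_extension_ge _ [set x | Fu x = 0] cP.
rewrite P1 poss; apply/negP; rewrite -ltNge; apply: le_lt_trans ltr01.
apply: ge_sup => [|_ [x x0 <-]]; last by rewrite natural_extension1_zero.
by have [x x0] := C0; exists (natural_extension Fl Fu [set x]), x.
Qed.

(** * Sufficiency of (i) and (ii), and the formula *)

Section Sufficiency.
Hypotheses (complete : order_complete (squot T))
  (Fl_right : forall x,
     ~ (exists y, immediate_succ x y) -> Fl x = cdf_right Fl x)
  (C_max : exists m, is_max (zero_set Fu) m).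

Let leftA A := [set cdf_left Fl y | y in A `&` [set y | (~` zero_set Fu) (Some y)]].

Let leftA_ge0 A : lbound (leftA A) 0.
Proof. by move=> _ [y _ <-]; case/andP: (cdf_left01 Fl cdfFl y). Qed.

(** A maximum [m] of [C] in the space encloses the set in a segment of mass at most [Fu m = 0]; if
    the maximum is [None], the set is empty. *)
Lemma credal_zero_set P : credal Fl Fu P -> P [set x | Fu x = 0] = 0.
Proof.
move=> [PP Pb]; apply/eqP; rewrite eq_le; case: (PP) => P0 _ _; rewrite P0 andbT.
have [[m|] [m0 mmax]] := C_max.
  have /andP[_] := Pb m; rewrite [Fu m]m0; apply: le_trans.
  by apply: fin_add_proba_le => // x x0; exact: (mmax (Some x)).
have -> : [set x | Fu x = 0] = ~` setT.
  by rewrite setCT -subset0 => x x0; have := mmax (Some x) x0.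
by rewrite fin_add_probaC//; case: PP => _ -> _; rewrite subrr.
Qed.

Lemma credal_le_inf_left P A : credal Fl Fu P -> P A <= 1 - inf01 (leftA A).
Proof.
move=> cP; have [PP Pb] := cP.
(* The part of [A] outside [C] carries all the mass of [A]. *)
pose B := [set y | A y /\ Fu y = 1].
have BA y : B y -> leftA A (cdf_left Fl y).
  move=> [Ay y1]; exists y => //; split=> //=.
  by rewrite /zero_set /= y1; apply/eqP; exact: oner_neq0.
have PAB : P A <= P B.
  have /fin_add_probaP[_ _ PU] := PP.
  rewrite -[leRHS]add0r -(credal_zero_set _ cP) -PU; last first.
    rewrite -subset0 => x [/= x0 [_ x1]].
    by move/eqP: x1; rewrite x0 eq_sym oner_eq0.
  apply: fin_add_proba_le => // x Ax /=.
  by have [|] := Fu01 x; [left|right].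
apply: le_trans PAB _.
have [[y0 By0]|B0] := pselect (exists y, B y); last first.
  have -> : leftA A = set0.
    rewrite -subset0 => ? [y [Ay /= /Fu_neq0 y1] _].
    by apply: B0; exists y.
  rewrite inf01_set0 subrr -(credal_zero_set _ cP).
  by apply: fin_add_proba_le => // y By; exfalso; apply: B0; exists y.
have [b [bB b_glb]] := order_complete_glb B complete.
(* If the infimum [b] is attained, up to equivalence, by some [y] in [B], the bound at [y]
   suffices. *)
have [[y [By yb]]|nattained] := pselect (exists y, B y /\ (y <= b)%O).
  have yB z : B z -> (y <= z)%O by move=> /bB; exact: le_trans.
  apply: le_trans (credal_le_cdf_left _ _ _ cP yB) _.
  by rewrite lerB//; apply: inf01_le; [exact: leftA_ge0|exact: BA].
have bB_lt y : B y -> (b < y)%O.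
  by move=> By; apply/(total_leNgt tot) => yb; apply: nattained; exists y.
have B_near z : (b < z)%O -> exists2 y, B y & (y < z)%O.
  move=> bz; apply: contrapT => nB; have : (z <= b)%O; last exact/total_leNgt.
  apply: b_glb => y By; apply/(total_ltNge tot) => yz; apply: nB.
  by exists y.
(* Points of [B] accumulate at [b] from above, so (i) applies to [b]. *)
have nsucc : ~ exists z, immediate_succ b z.
  move=> [z [bz nbz]]; have [y By yz] := B_near _ bz.
  by apply: nbz; exists y; rewrite bB_lt.
have PB : P B <= 1 - P [set z | (z <= b)%O].
  by apply: fin_add_proba_le_disj => // z /bB_lt /(total_leNgt tot).
suff : inf01 (leftA A) <= Fl b by case/andP: (Pb b); lra.
(* Each [z] above [b] has some [y] of [B] below it, and [Fl(y-) <= Fl z]. *)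
rewrite Fl_right//; apply: inf01_ge.
  apply: le_trans (inf01_le _ _ (leftA_ge0 A) (BA _ By0)) _.
  by case/andP: (cdf_left01 Fl cdfFl y0).
move=> _ [z bz <-]; have [y By yz] := B_near _ bz.
apply: le_trans (inf01_le _ _ (leftA_ge0 A) (BA _ By)) _.
by apply: cdf_left_le => // x xy; apply: Fl_homo; apply: ltW; exact: lt_trans yz.
Qed.

(** Used with [c] the upper probability of [A] for the formula, and with [c] the supremum over its
    singletons for the possibility property. The condition [0 <= c] covers an infimum over the empty
    set. *)
Let inf_left_ge A (c : R) : 0 <= c ->
  (forall y, A y -> natural_extension Fl Fu [set y] <= c) ->
  1 - inf01 (leftA A) <= c.
Proof.
move=> c0 Ac; rewrite lerBlDr -lerBlDl; apply: inf01_ge; first by lra.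
move=> _ [y [Ay /= /Fu_neq0 y1] <-]; have := Ac _ Ay.
by rewrite natural_extension1//; lra.
Qed.

Lemma natural_extension_inf_left A :
  natural_extension Fl Fu A = 1 - inf01 (leftA A).
Proof.
apply/eqP; rewrite eq_le; apply/andP; split.
  by apply: natural_extension_le => P; exact: credal_le_inf_left.
apply: inf_left_ge => [|y Ay]; first exact: natural_extension_ge0.
by apply: natural_extension_mono => _ ->.
Qed.

Lemma possibility_of_cdf_right : is_possibility Fl Fu.
Proof.
move=> A; apply/eqP; rewrite eq_le; apply/andP; split; last first.
  have [->|/set0P[x Ax]] := eqVneq A set0.
    by rewrite image_set0 sup0 natural_extension_ge0.
  apply: ge_sup; first by exists (natural_extension Fl Fu [set x]), x.
  by move=> _ [y Ay <-]; apply: natural_extension_mono => _ ->.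
have ub : has_ubound [set natural_extension Fl Fu [set x] | x in A].
  by exists 1 => _ [x _ <-]; exact: natural_extension_le1.
have le_sup x : A x -> natural_extension Fl Fu [set x] <=
    sup [set natural_extension Fl Fu [set x] | x in A].
  by move=> Ax; apply: ub_le_sup => //; exists x.
(* The nontrivial inequality goes through the formula; for empty [A] the supremum is 0. *)
rewrite natural_extension_inf_left; apply: inf_left_ge => //.
have [->|/set0P[x Ax]] := eqVneq A set0; first by rewrite image_set0 sup0.
exact: le_trans (natural_extension_ge0 _) (le_sup _ Ax).
Qed.

End Sufficiency.
End ZeroOnePBox.

Theorem proposition16 (R : realType) (d : Order.disp_t)
    (Omega : tbPreorderType d) (Fl Fu : Omega -> R) :
  total (<=%O : rel Omega) ->
  order_complete (squot Omega) ->
  pbox Fl Fu ->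
  zero_one_valued Fu ->
  let C := zero_set Fu in
  (is_possibility Fl Fu <->
     (forall x : Omega,
        ~ (exists y, immediate_succ x y) -> Fl x = cdf_right Fl x) /\
     (exists m, is_max C m)) /\
  (is_possibility Fl Fu ->
     forall A : set Omega,
       natural_extension Fl Fu A =
         1 - inf01 [set cdf_left Fl y | y in A `&` [set y | (~` C) (Some y)]]).
Proof.
move=> tot complete FlFu Fu01 C.
have nec : is_possibility Fl Fu ->
    (forall x, ~ (exists y, immediate_succ x y) -> Fl x = cdf_right Fl x) /\
    (exists m, is_max C m).
  move=> poss; split=> [x|].
    exact: (possibility_cdf_right _ _ tot FlFu Fu01).
  exact: (possibility_zero_set_max _ _ tot FlFu Fu01).
split; first split=> // -[Fl_right C_max].
  exact: (possibility_of_cdf_right _ _ tot FlFu Fu01).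
(* The formula rests on (i) and (ii), which necessity supplies. *)
move=> /nec[Fl_right C_max] A.
exact: (natural_extension_inf_left _ _ tot FlFu Fu01).
Qed.
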